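(* The polynomials $P(T)(t)$, for planar rooted trees $T$, satisfy $P(\bullet)(t)=1$ and, for all planar rooted trees $T,T_1,\ldots,T_k$, $k\ge1$: \[ P(R(T_1,\ldots,T_k))(t)=\prod_{j=1}^kP(R(T_j))(t),\qquad P(R(T))(t)=\sum_{\tau=0}^{t-1}P(T)(-\tau), \] where $R(T_1,\ldots,T_k)$ is the planar rooted tree whose root has, from left to right, children the roots of $T_1,\ldots,T_k$; these relations determine the polynomials.
   Context: $\mathbb{K}$ has characteristic zero. Planar binary rooted trees have a univalent root; $|$ is the one-leaf tree; $T\vee T'$ denotes the tree whose root edge ends at an inner vertex with left subtree $T$ and right subtree $T'$; every planar binary rooted tree other than $|$ is uniquely $T_1\vee(T_2\vee(\cdots(T_k\vee|)\cdots))$, $k\ge1$. Each non-root edge is right/left pointing (to a right/left child); the root edge counts as right pointing. For an edge $e$ of $T'$, $T\searrow_eT'$ subdivides $e$ by a new vertex whose right child is the part of $T'$ above $e$ and whose left child is $T$; $T\rhd T'=\sum_{e\text{ right}}T\searrow_eT'-\sum_{e\text{ left}}T\searrow_eT'$ on $\mathcal{T}_{\mathrm{pb}}=\prod_n\mathcal{T}_{\mathrm{pb}}(n)$. Let $P=\sum_TP(T)(t)T$ (polynomial coefficients) solve $P'=\langle\frac{D}{1-e^{-D}}|P\rangle\rhd P$, $P(0)=|$, where $\langle\frac{D}{1-e^{-D}}|\cdot\rangle$ is the functional $t^n\mapsto(-1)^nB_n$ ($B_n$ Bernoulli numbers) applied coefficientwise. $\Sigma$ is the mirror involution $\Sigma(|)=|$,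 $\Sigma(T_1\vee T_2)=\Sigma(T_2)\vee\Sigma(T_1)$. The $\Sigma$-twisted rotation correspondence $\Phi$ from planar binary rooted trees with $n$ leaves to planar rooted trees with $n$ vertices (a bijection) is defined by $\Phi(|)=\bullet$ and $\Phi(T_1\vee(\cdots(T_k\vee|)\cdots))=R(\Phi(\Sigma T_1),\ldots,\Phi(\Sigma T_k))$. For a planar rooted tree $T$, $P(T)(t):=P(\Phi^{-1}(T))(t)$. $\sum_{\tau=0}^{t-1}q(\tau)$ is the unique polynomial $Q$ with $Q(0)=0$, $Q(t+1)-Q(t)=q(t)$.
   Formalization: When the edge e is left pointing, the grafted tree T is taken as the right child of the new vertex (the part of T' above e as the left child), not the left child as described; with the literal description the sum relation fails for R(R(R(•))). *)

(* Defs.v *)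
From HB Require Import structures.
From mathcomp Require Import all_boot all_order all_algebra.

Set Implicit Arguments.
Unset Strict Implicit.
Unset Printing Implicit Defensive.

Import GRing.Theory.

Local Open Scope ring_scope.

(* [Node l r] is l \/ r; the root edge is not represented by a constructor. *)
Inductive pbtree := Leaf | Node of pbtree & pbtree.

Fixpoint pbtree_encode (T : pbtree) : GenTree.tree unit :=
  if T is Node l r then GenTree.Node 0 [:: pbtree_encode l; pbtree_encode r]
  else GenTree.Leaf tt.

Fixpoint pbtree_decode (t : GenTree.tree unit) : pbtree :=
  if t is GenTree.Node _ [:: l; r]
  then Node (pbtree_decode l) (pbtree_decode r) else Leaf.

Lemma pbtree_encodeK : cancel pbtree_encode pbtree_decode.
Proof. by elim=> //= l -> r ->. Qed.

HB.instance Definition _ := Countable.copy pbtree (can_type pbtree_encodeK).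

Fixpoint leaves (T : pbtree) : nat :=
  if T is Node l r then (leaves l + leaves r)%N else 1%N.

Fixpoint mirror (T : pbtree) : pbtree :=
  if T is Node l r then Node (mirror r) (mirror l) else Leaf.

(* [:: T_1; ...; T_k] |-> T_1 \/ (T_2 \/ (... (T_k \/ |) ...)), and its inverse *)
Definition comb (s : seq pbtree) : pbtree := foldr Node Leaf s.

Fixpoint spine (T : pbtree) : seq pbtree :=
  if T is Node l r then l :: spine r else [::].

Fixpoint shallow_trees (h : nat) : seq pbtree :=
  if h is h'.+1 then
    Leaf :: [seq Node l r | l <- shallow_trees h', r <- shallow_trees h']
  else [::].

(* A binary tree with n leaves has at most n levels. *)
Definition trees (n : nat) : seq pbtree :=
  [seq T <- shallow_trees n | leaves T == n].

(* An edge is the path (false = left, true = right) to its upper vertex; the  *)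
(* empty path is the root edge.                                               *)
Definition edge := seq bool.

Fixpoint edges (T : pbtree) : seq edge :=
  [::] :: if T is Node l r then
            [seq false :: e | e <- edges l] ++ [seq true :: e | e <- edges r]
          else [::].

Definition right_pointing (e : edge) : bool := last true e.

(* Replaces the part U of T above e by f U. *)
Fixpoint apply_above (f : pbtree -> pbtree) (e : edge) (T : pbtree) : pbtree :=
  match e, T with
  | [::], _ => f T
  | true :: e', Node l r => Node l (apply_above f e' r)
  | false :: e', Node l r => Node (apply_above f e' l) r
  | _ :: _, Leaf => Leaf
  end.

(* Both halves of the subdivided edge e keep the direction of e, so T becomes *)
(* the left child of the new vertex when e is right pointing and its right    *)
(* child when e is left pointing.  Attaching T on the left of left pointing   *)
(* edges as well would make [prelie] below fail the pre-Lie identity.         *)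
Definition graft (T : pbtree) (e : edge) (T' : pbtree) : pbtree :=
  apply_above (fun U => if right_pointing e then Node T U else Node U T) e T'.

Section Series.
Variable R : pzRingType.

(* An element of \prod_n T_pb(n) over R is its family of coefficients.        *)
Definition series := pbtree -> R.

(* The coefficient of S in the product of the trees T and T'. *)
Definition prelie_coef (T T' S : pbtree) : R :=
  \sum_(e <- edges T' | graft T e T' == S) (-1) ^+ ~~ right_pointing e.

Definition prelie (a b : series) : series := fun S =>
  \sum_(i < leaves S) \sum_(T <- trees i) \sum_(T' <- trees (leaves S - i))
     a T * b T' * prelie_coef T T' S.

End Series.

Section Polynomials.
Variable K : fieldType.

(* B_0, ..., B_n, from \sum_(k <= m) 'C(m+1, k) B_k = 0 for m > 0; thus       *)
(* B_1 = -1/2.                                                                *)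
Fixpoint bernoulli_seq (n : nat) : seq K :=
  if n is n'.+1 then
    let s := bernoulli_seq n' in
    rcons s (- (\sum_(k < n'.+1) 'C(n'.+2, k)%:R * s`_k) / n'.+2%:R)
  else [:: 1].

Definition bernoulli (n : nat) : K := (bernoulli_seq n)`_n.

(* The functional < D / (1 - e^{-D}) | p >, i.e. t^n |-> (-1)^n B_n. *)
Definition todd (p : {poly K}) : K :=
  \sum_(n < size p) p`_n * ((-1) ^+ n * bernoulli n).

Definition solves_flow (P : series {poly K}) : Prop :=
  (forall S, (P S)^`() = prelie (fun T => (todd (P T))%:P) P S)
  /\ (forall S, (P S).[0] = (S == Leaf)%:R).

(* Q(t) = \sum_(tau = 0)^(t - 1) q(tau) *)
Definition is_indefinite_sum (q Q : {poly K}) : Prop :=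
  Q.[0] = 0 /\ (Q \Po ('X + 1)) - Q = q.

End Polynomials.

(* [PRoot [:: T_1; ...; T_k]] is R(T_1, ..., T_k). *)
Inductive prtree := PRoot of seq prtree.

Definition bullet : prtree := PRoot [::].

Fixpoint vertices (T : prtree) : nat :=
  let: PRoot s := T in (sumn [seq vertices T' | T' <- s]).+1.

(* Phi is not structurally recursive because of the mirror; the fuel          *)
(* [leaves T] is sufficient, see [Phi_comb].                                  *)
Fixpoint Phi_fuel (n : nat) (T : pbtree) : prtree :=
  if n is n'.+1 then PRoot [seq Phi_fuel n' (mirror T') | T' <- spine T]
  else bullet.

Definition Phi (T : pbtree) : prtree := Phi_fuel (leaves T) T.

Fixpoint Phi_inv (T : prtree) : pbtree :=
  let: PRoot s := T in comb [seq mirror (Phi_inv T') | T' <- s].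

Section PlanarTrees.
Variable K : fieldType.

Definition tree_relations (Q : prtree -> {poly K}) : Prop :=
  [/\ Q bullet = 1,
      forall s : seq prtree, (0 < size s)%N ->
        Q (PRoot s) = \prod_(T <- s) Q (PRoot [:: T])
    & forall T : prtree,
        is_indefinite_sum (Q T \Po (- 'X)) (Q (PRoot [:: T]))].

End PlanarTrees.

(* ------------------------------------------------------------------------ *)

Lemma leaves_gt0 T : (0 < leaves T)%N.
Proof. by elim: T => //= l lP r _; rewrite addn_gt0 lP. Qed.

Lemma mirrorK : involutive mirror.
Proof. by elim=> //= l -> r ->. Qed.

Lemma leaves_mirror T : leaves (mirror T) = leaves T.
Proof. by elim: T => //= l -> r ->; rewrite addnC. Qed.

Lemma spineK : cancel spine comb.
Proof. by elim=> //= l _ r ->. Qed.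

Lemma combK : cancel comb spine.
Proof. by elim=> //= T s ->. Qed.

Lemma mem_shallow_trees h T : (leaves T <= h)%N -> T \in shallow_trees h.
Proof.
elim: h T => [|h IH] [|l r] //=; first by rewrite leqNgt addn_gt0 leaves_gt0.
move=> le_h; rewrite inE; apply/orP; right; apply/allpairsP; exists (l, r).
have := leaves_gt0 l; have := leaves_gt0 r => r0 l0; split=> //; apply: IH;
  rewrite -ltnS; apply: leq_trans le_h.
  by rewrite -addn1 leq_add2l.
by rewrite -add1n leq_add2r.
Qed.

Lemma uniq_shallow_trees h : uniq (shallow_trees h).
Proof.
elim: h => //= h IH; apply/andP; split; first by apply/allpairsP => -[[l r] []].
by apply: allpairs_uniq => // -[l r] [l' r'] _ _ /= [-> ->].
Qed.

Lemma mem_trees n T : (T \in trees n) = (leaves T == n).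
Proof.
rewrite mem_filter andbC; case: eqP => [<-|_]; last exact: andbF.
by rewrite mem_shallow_trees.
Qed.

Lemma uniq_trees n : uniq (trees n).
Proof. exact/filter_uniq/uniq_shallow_trees. Qed.

Lemma leaves_graft T e T' : e \in edges T' ->
  leaves (graft T e T') = (leaves T + leaves T')%N.
Proof.
rewrite /graft; move: (right_pointing e) => b.
elim: T' e => [|l IHl r IHr] [|d e] //=;
  try by move=> _; case: (b) => //=; rewrite addnC.
rewrite in_cons /= mem_cat => /orP[] /mapP[e' e'P [-> ->]] /=.
  by rewrite IHl // addnA.
by rewrite IHr // addnCA.
Qed.

Lemma size_bernoulli_seq (K : fieldType) n : size (bernoulli_seq K n) = n.+1.
Proof. by elim: n => //= n IH; rewrite size_rcons IH. Qed.

Lemma nth_bernoulli_seq (K : fieldType) n k :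
  (k <= n)%N -> (bernoulli_seq K n)`_k = bernoulli K k.
Proof.
elim: n => [|n IH]; first by rewrite leqn0 => /eqP->.
rewrite leq_eqVlt => /orP[/eqP-> //|]; rewrite ltnS => lekn /=.
by rewrite nth_rcons size_bernoulli_seq ltnS lekn IH.
Qed.

Lemma bernoulliE (K : fieldType) (charK : [pchar K] =i pred0) n :
  \sum_(k < n.+1) 'C(n.+1, k)%:R * bernoulli K k = (n == 0%N)%:R.
Proof.
case: n => [|n]; first by rewrite big_ord1 bin0 mul1r.
rewrite big_ord_recr /= {2}/bernoulli /= nth_rcons size_bernoulli_seq ltnn eqxx.
rewrite binSn mulrC divfK; last by rewrite ((pcharf0P K).1 charK).
apply/eqP; rewrite subr_eq0; apply/eqP; apply: eq_bigr => k _.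
by rewrite nth_bernoulli_seq // -ltnS.
Qed.

Lemma Phi_fuelE n T : (leaves T <= n)%N -> Phi_fuel n T = Phi T.
Proof.
have gen m p U : (leaves U <= m)%N -> (leaves U <= p)%N ->
    Phi_fuel m U = Phi_fuel p U.
  elim: m p U => [|m IH] [|p] U; rewrite ?leqn0 ?(gtn_eqF (leaves_gt0 _)) //=.
  move=> leUm leUp; congr PRoot.
  have : all (fun V => leaves V < leaves U)%N (spine U).
    elim: U {leUm leUp} => //= l _ r IHr.
    rewrite -addn1 leq_add2l leaves_gt0 /=.
    by apply: sub_all IHr => V ltV; rewrite ltn_addl.
  move=> /allP ltU; apply/eq_in_map => V /ltU ltVU.
  by apply: IH; rewrite leaves_mirror -ltnS; apply: leq_trans ltVU _.
by move=> leTn; apply: gen.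
Qed.

Lemma Phi_comb s : Phi (comb s) = PRoot [seq Phi (mirror T) | T <- s].
Proof.
have -> : Phi (comb s) = Phi_fuel (leaves (comb s)).+1 (comb s).
  by rewrite Phi_fuelE.
rewrite /= combK; congr PRoot; apply/eq_in_map => T sT.
apply: Phi_fuelE; rewrite leaves_mirror.
elim: s sT => //= U s IH; rewrite inE => /orP[/eqP->|/IH leT].
  exact: leq_addr.
exact: leq_trans leT (leq_addl _ _).
Qed.

Lemma Phi_leaf : Phi Leaf = bullet.
Proof. by []. Qed.

Lemma prtree_ind_seq (A : prtree -> Prop) :
    (forall s, foldr (fun T B => A T /\ B) True s -> A (PRoot s)) ->
  forall T, A T.
Proof.
move=> AR; fix ih 1; case=> s; apply: AR.
by elim: s => //= T s IHs; split.
Qed.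

Lemma Phi_invK : cancel Phi_inv Phi.
Proof.
elim/prtree_ind_seq=> s IH /=; rewrite Phi_comb -map_comp; congr PRoot.
by elim: s IH => //= T s IHs [eqT /IHs ->]; rewrite mirrorK eqT.
Qed.

Lemma PhiK : cancel Phi Phi_inv.
Proof.
move=> T; have [n] := ubnP (leaves T); elim: n T => // n IH T.
rewrite ltnS => leTn; rewrite -{1}(spineK T) Phi_comb /= -map_comp.
rewrite -[RHS]spineK; congr comb; rewrite -[RHS]map_id.
have : all (fun V => leaves V < leaves T)%N (spine T).
  elim: T {leTn} => //= l _ r IHr.
  rewrite -addn1 leq_add2l leaves_gt0 /=.
  by apply: sub_all IHr => V ltV; rewrite ltn_addl.
move=> /allP ltT; apply/eq_in_map => V /ltT ltVT /=.
by rewrite IH ?mirrorK // leaves_mirror (leq_trans ltVT).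
Qed.

Lemma Phi_bij : bijective Phi.
Proof. by exists Phi_inv; [exact: PhiK | exact: Phi_invK]. Qed.

Lemma vertices_Phi T : vertices (Phi T) = leaves T.
Proof.
have [n] := ubnP (leaves T); elim: n T => // n IH T.
rewrite ltnS -(spineK T) Phi_comb => le_n /=; rewrite -map_comp.
elim: (spine T) le_n => //= U s IHs le_n.
rewrite -addnS IHs; last exact: leq_trans (leq_addl _ _) le_n.
congr addn; rewrite IH leaves_mirror //; apply: leq_trans le_n.
by rewrite -addn1 leq_add2l leaves_gt0.
Qed.

Section CharacteristicZero.
Variable K : fieldType.
Hypothesis charK : [pchar K] =i pred0.

Lemma is_indefinite_sum_uniq (q Q1 Q2 : {poly K}) :
  is_indefinite_sum q Q1 -> is_indefinite_sum q Q2 -> Q1 = Q2.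
Proof.
move=> [Q10 Q1q] [Q20 Q2q]; apply/eqP; rewrite -subr_eq0; set Q := Q1 - Q2.
have QX : Q \Po ('X + 1) = Q.
  have e1 : Q1 \Po ('X + 1) = q + Q1 by rewrite -Q1q subrK.
  have e2 : Q2 \Po ('X + 1) = q + Q2 by rewrite -Q2q subrK.
  by rewrite comp_polyB e1 e2 opprD addrACA subrr add0r.
have Q0 : Q.[0] = 0 by rewrite hornerD hornerN Q10 Q20 subrr.
clearbody Q; have Qn n : Q.[n%:R] = 0.
  elim: n => // n IHn.
  by rewrite -[RHS]IHn -[in RHS]QX horner_comp hornerD hornerX hornerC natr1.
apply/negPn/negP => Q_neq0.
pose s := [seq n%:R : K | n <- iota 0 (size Q)].
have /(max_poly_roots Q_neq0) : all (root Q) s.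
  by apply/allP => x /mapP[n _ ->]; rewrite /root Qn.
rewrite size_map size_iota ltnn => sP; apply/notF/sP.
rewrite map_inj_uniq ?iota_uniq // => m n /eqP.
have natrI (i j : nat) : (i <= j)%N -> (i%:R == j%:R :> K) = (i == j).
  move=> le_ij; rewrite eq_sym -subr_eq0 -natrB // ((pcharf0P K).1 charK) subn_eq0.
  by rewrite eqn_leq le_ij.
by case: (leqP m n) => [|/ltnW] le_mn; [|rewrite eq_sym]; rewrite natrI // => /eqP.
Qed.

Lemma deriv_horner0_inj (p q : {poly K}) :
  p^`() = q^`() -> p.[0] = q.[0] -> p = q.
Proof.
move=> dpq pq0; apply/polyP => -[|i]; first by rewrite -!horner_coef0.
have := congr1 (fun s : {poly K} => s`_i) dpq.
rewrite !coef_deriv -[p`_i.+1 *+ _]mulr_natr -[q`_i.+1 *+ _]mulr_natr.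
by apply: mulIf; rewrite ((pcharf0P K).1 charK).
Qed.

Definition primitive (c : K) (p : {poly K}) : {poly K} :=
  \poly_(i < (size p).+1) (if i is j.+1 then p`_j / i%:R else c).

Lemma primitive0 c p : (primitive c p).[0] = c.
Proof. by rewrite horner_coef0 coef_poly. Qed.

Lemma deriv_primitive c p : (primitive c p)^`() = p.
Proof.
apply/polyP => i; rewrite coef_deriv coef_poly ltnS.
case: ltnP => [_|le_pi]; last by rewrite mul0rn nth_default.
by rewrite -[_ *+ i.+1]mulr_natr divfK // ((pcharf0P K).1 charK).
Qed.

Lemma eq_prelie (a a' b b' : series {poly K}) S :
    (forall T, (leaves T < leaves S)%N -> a T = a' T) ->
    (forall T, (leaves T < leaves S)%N -> b T = b' T) ->
  prelie a b S = prelie a' b' S.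
Proof.
move=> eqa eqb; apply: eq_bigr => i _; apply: eq_big_seq => T.
rewrite mem_trees => /eqP Ti; apply: eq_big_seq => T'.
rewrite mem_trees => /eqP T'i; rewrite eqa ?Ti // eqb // T'i.
by rewrite ltn_subrL -Ti !leaves_gt0.
Qed.

Fixpoint flow_fuel (n : nat) : series {poly K} := fun S =>
  if n is n'.+1 then
    primitive (S == Leaf)%:R
      (prelie (fun T => (todd (flow_fuel n' T))%:P) (flow_fuel n') S)
  else 0.

Lemma flow_fuelS n S :
  flow_fuel n.+1 S = primitive (S == Leaf)%:R
    (prelie (fun T => (todd (flow_fuel n T))%:P) (flow_fuel n) S).
Proof. by []. Qed.

Lemma solves_flow_exists : exists P : series {poly K}, solves_flow P.
Proof.
have stable m p T : (leaves T <= m)%N -> (leaves T <= p)%N ->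
    flow_fuel m T = flow_fuel p T.
  elim: m p T => [|m IH] [|p] T; rewrite ?leqn0 ?(gtn_eqF (leaves_gt0 _)) //=.
  move=> leTm leTp; congr primitive.
  have eqf U : (leaves U < leaves T)%N -> flow_fuel m U = flow_fuel p U.
    by move=> ltU; apply: IH; rewrite -ltnS; apply: leq_trans ltU _.
  by apply: eq_prelie => U ltU; rewrite eqf.
have flowE S : flow_fuel (leaves S) S = flow_fuel (leaves S).+1 S.
  by apply: stable.
exists (fun S => flow_fuel (leaves S) S); split=> S; rewrite flowE flow_fuelS.
  rewrite deriv_primitive; apply: eq_prelie => T /ltnW leT.
    by rewrite (stable _ _ T leT (leqnn _)).
  exact: stable leT (leqnn _).
exact: primitive0.
Qed.

Lemma solves_flow_uniq (P Q : series {poly K}) :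
  solves_flow P -> solves_flow Q -> P =1 Q.
Proof.
move=> [dP P0] [dQ Q0] S; have [n] := ubnP (leaves S).
elim: n S => // n IH S; rewrite ltnS => leSn.
have eqPQ T : (leaves T < leaves S)%N -> P T = Q T.
  by move=> ltT; apply: IH; apply: leq_trans ltT leSn.
apply: deriv_horner0_inj; last by rewrite P0 Q0.
by rewrite dP dQ; apply: eq_prelie => T ltT; rewrite eqPQ.
Qed.

End CharacteristicZero.

(* Main.v *)
(** Read on binary trees, the relations say [Q | = 1] and
    [Q (l \/ r) = W l * Q r], where [W l] is the indefinite sum of
    [V l := Q (mirror l)(- t)].  They define a family [Q]; it suffices to see
    that [Q] solves the flow equation, whose solution is unique.  The Todd
    functional of [p] is the linear coefficient of the indefinite sum of
    [p(- t)].  Summation by parts shows that this coefficient, applied to [Q],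
    is invariant under the mirror, and the flow equation for [V l] then sums up
    to the one for [W l]; the Todd coefficient is the constant of summation. *)

Require Import Defs.
From HB Require Import structures.
From mathcomp Require Import all_boot all_order all_algebra ring.
Import GRing.Theory.
Local Open Scope ring_scope.

Set Implicit Arguments.
Unset Strict Implicit.
Unset Printing Implicit Defensive.

(** * Grafting read backwards: cutting a tree at its inner vertices *)

Lemma eq_Node l r l' r' : (Node l r == Node l' r') = (l == l') && (r == r').
Proof. by apply/eqP/andP => [[-> ->]|[/eqP-> /eqP->]]. Qed.

(* The triples (direction of e, T, T') with [graft T e T' = S], where [d] is  *)
(* the direction of the root edge of S; each inner vertex of S gives one.     *)
Fixpoint cuts (d : bool) (S : pbtree) : seq (bool * pbtree * pbtree) :=
  if S is Node l r then
    (d, if d then l else r, if d then r else l) ::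
      [seq (c.1, Node c.2 r) | c <- cuts false l]
      ++ [seq (c.1, Node l c.2) | c <- cuts true r]
  else [::].

(** Induction on [S]: the root edge of [T'] matches the cut at the root vertex, the other edges
    match the cuts inside [l] and [r]. The direction [d] is general because each subtree hangs from
    an edge with its own direction. *)
Lemma graft_coef_cuts (R : pzRingType) d T T' S :
  \sum_(e <- edges T' | apply_above
           (fun U => if last d e then Node T U else Node U T) e T' == S)
     (-1) ^+ (~~ last d e)
  = \sum_(c <- cuts d S | (c.1.2 == T) && (c.2 == T')) ((-1) ^+ (~~ c.1.1) : R).
Proof.
elim: S d T' => [|l IHl r IHr] d T'.
  rewrite big_nil big_seq_cond big1 // => e /andP[eT'].
  by case: T' eT' => [|l r]; case: e => [|[] e] //=; case: d.
have -> : edges T' = [::] :: behead (edges T') by case: T'.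
rewrite big_cons [in RHS]big_cons /=.
have -> : ((if d then Node T T' else Node T' T) == Node l r)
    = ((if d then l else r) == T) && ((if d then r else l) == T').
  by case: d; rewrite eq_Node ![T == _]eq_sym ![T' == _]eq_sym // andbC.
suff -> : \sum_(e <- behead (edges T') | apply_above
           (fun U => if last d e then Node T U else Node U T) e T' == Node l r)
     (-1) ^+ (~~ last d e)
  = \sum_(c <- [seq (c.1, Node c.2 r) | c <- cuts false l]
      ++ [seq (c.1, Node l c.2) | c <- cuts true r]
         | (c.1.2 == T) && (c.2 == T')) ((-1) ^+ (~~ c.1.1) : R) by [].
rewrite big_cat !big_map /=; case: T' => [|l' r'] /=.
  (* The one-leaf tree has only its root edge, while cuts inside [l] or [r] have a [Node] as second
     component. *)
  by rewrite big_nil !big1 ?addr0 // => c /andP[_]; case: eqP.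
rewrite big_cat !big_map /=; congr (_ + _).
- under eq_bigl do rewrite eq_Node.
  under [RHS]eq_bigl do rewrite eq_Node [r == r']eq_sym andbA.
  case: (r' == r); last by rewrite !big_pred0 // => c; rewrite andbF.
  under eq_bigl do rewrite andbT; under [RHS]eq_bigl do rewrite andbT.
  exact: IHl.
- under eq_bigl do rewrite eq_Node.
  under [RHS]eq_bigl do rewrite eq_Node [l == l']eq_sym andbCA.
  case: (l' == l); last by rewrite !big_pred0.
  exact: IHr.
Qed.

Lemma leaves_cuts d S c : c \in cuts d S ->
  (leaves c.1.2 + leaves c.2)%N = leaves S.
Proof.
elim: S d c => [|l IHl r IHr] d c //=; rewrite in_cons mem_cat.
case/or3P => [/eqP-> /=|/mapP[c' /IHl<- ->]|/mapP[c' /IHr<- ->]] /=.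
- by case: d => //; rewrite addnC.
- by rewrite addnA.
- by rewrite addnCA.
Qed.

(** Each cut determines its pair of trees, so exchanging the sums leaves one term per cut. *)
Lemma prelie_cuts (R : comPzRingType) (a b : series R) S :
  prelie a b S = \sum_(c <- cuts true S) (-1) ^+ (~~ c.1.1) * a c.1.2 * b c.2.
Proof.
rewrite /prelie.
transitivity (\sum_(i < leaves S) \sum_(T <- trees i)
    \sum_(T' <- trees (leaves S - i)) \sum_(c <- cuts true S)
      if (c.1.2 == T) && (c.2 == T')
      then (-1) ^+ (~~ c.1.1) * a c.1.2 * b c.2 else 0).
  apply: eq_bigr => i _; apply: eq_bigr => T _; apply: eq_bigr => T' _.
  rewrite /prelie_coef /graft /right_pointing graft_coef_cuts -big_mkcond.
  rewrite mulr_sumr; apply: eq_bigr => c /andP[/eqP-> /eqP->].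
  by rewrite mulrC mulrA.
under eq_bigr => i _ do under eq_bigr => T _ do rewrite exchange_big.
under eq_bigr => i _ do rewrite exchange_big.
rewrite exchange_big; apply: eq_big_seq => c cS /=.
have eqS := leaves_cuts cS.
have ltS : (leaves c.1.2 < leaves S)%N.
  by rewrite -eqS -addn1 leq_add2l leaves_gt0.
rewrite (bigD1 (Ordinal ltS)) //= [X in _ + X]big1 ?addr0 => [|i ne_i]; last first.
  rewrite big_seq big1 // => T; rewrite mem_trees => /eqP Ti.
  rewrite big1 // => T' _; case: eqP => //= cT.
  by case/eqP: ne_i; apply: val_inj; rewrite /= cT Ti.
rewrite (bigD1_seq c.1.2) ?uniq_trees ?mem_trees //=.
rewrite [X in _ + X]big1 ?addr0 => [|T /negPf neT]; last first.
  by rewrite big1 // => T' _; rewrite eq_sym neT.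
rewrite (bigD1_seq c.2) ?uniq_trees ?mem_trees -?eqS ?addKn //=.
rewrite !eqxx /= big1 ?addr0 // => T' /negPf neT'.
by rewrite eq_sym neT'.
Qed.

(** * Weighted sums over cuts *)

Section CutSum.
Variables (K : fieldType) (A : pbtree -> K) (M : lmodType K).

(** With [d] true, polynomial values and Todd coefficients as weights, this is the right-hand side
    of the flow equation; [d] false serves left subtrees. *)
Definition cut_sum (d : bool) (S : pbtree) (b : pbtree -> M) : M :=
  \sum_(c <- cuts d S) ((-1) ^+ (~~ c.1.1) * A c.1.2) *: b c.2.

Lemma cut_sum_Node d l r b :
  cut_sum d (Node l r) b =
    (if d then A l *: b r else - (A r *: b l))
    + cut_sum false l (fun x => b (Node x r))
    + cut_sum true r (fun x => b (Node l x)).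
Proof.
rewrite /cut_sum big_cons big_cat !big_map /= addrA; congr (_ + _ + _).
by case: d; rewrite /= ?expr0 ?mul1r // expr1 mulN1r scaleNr.
Qed.

Lemma eq_cut_sum d S b b' : b =1 b' -> cut_sum d S b = cut_sum d S b'.
Proof. by move=> eqb; apply: eq_bigr => c _; rewrite eqb. Qed.

Lemma cut_sumB d S b b' :
  cut_sum d S (fun x => b x - b' x) = cut_sum d S b - cut_sum d S b'.
Proof. by rewrite /cut_sum -sumrB; apply: eq_bigr => c _; rewrite scalerBr. Qed.

(** Mirroring reverses every edge, including the root edge through [~~ d], so every sign flips while
    the weights stay. *)
Lemma cut_sum_mirror : (forall T, A (mirror T) = A T) -> forall d S b,
  cut_sum (~~ d) (mirror S) b = - cut_sum d S (fun x => b (mirror x)).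
Proof.
move=> Am d S; elim: S d => [|l IHl r IHr] d b.
  by rewrite /cut_sum !big_nil oppr0.
rewrite /= !cut_sum_Node (IHr true) (IHl false) !Am addrAC !opprD.
by case: d; rewrite //= opprK.
Qed.

End CutSum.

Lemma cut_sum_linear (K : fieldType) (A : pbtree -> K) (M N : lmodType K)
    (f : {linear M -> N}) d S b :
  f (cut_sum A d S b) = cut_sum A d S (fun x => f (b x)).
Proof. by rewrite linear_sum; apply: eq_bigr => c _; rewrite linearZ. Qed.

Lemma cut_sum_comp (K : fieldType) (A : pbtree -> K) (b : series {poly K}) q d S :
  cut_sum A d S b \Po q = cut_sum A d S (fun x => b x \Po q).
Proof. exact: (cut_sum_linear A (comp_poly q)). Qed.

Lemma cut_sumMl (K : fieldType) (A : pbtree -> K) (b : series {poly K}) q d S :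
  cut_sum A d S (fun x => q * b x) = q * cut_sum A d S b.
Proof. by rewrite /cut_sum mulr_sumr; apply: eq_bigr => c _; rewrite scalerAr. Qed.

Lemma prelie_cut_sum (K : fieldType) (A : pbtree -> K) (b : series {poly K}) S :
  prelie (fun T => (A T)%:P) b S = cut_sum A true S b.
Proof.
rewrite prelie_cuts; apply: eq_bigr => c _.
by rewrite -mul_polyC polyCM polyC_exp polyCN.
Qed.

(** * The Todd functional and indefinite sums *)

Section Polynomials.
Variable K : fieldType.
Hypothesis charK : [pchar K] =i pred0.

Lemma todd_widen (p : {poly K}) n : (size p <= n)%N ->
  todd p = \sum_(i < n) p`_i * ((-1) ^+ i * bernoulli K i).
Proof.
move=> le_pn; rewrite /todd.
rewrite (big_ord_widen n (fun i => p`_i * ((-1) ^+ i * bernoulli K i))) //.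
rewrite big_mkcond; apply: eq_bigr => i _; case: ltnP => // le_pi.
by rewrite nth_default ?mul0r.
Qed.

Lemma todd_is_linear : linear_for *%R (@todd K).
Proof.
move=> c p q; pose n := maxn (size p) (size q).
have le_p : (size p <= n)%N by apply: leq_maxl.
have le_q : (size q <= n)%N by apply: leq_maxr.
have le_pq : (size (c *: p + q)%R <= n)%N.
  apply: leq_trans (size_polyD _ _) _; rewrite geq_max le_q andbT.
  exact: leq_trans (size_scale_leq _ _) le_p.
rewrite !(todd_widen le_p, todd_widen le_q, todd_widen le_pq) mulr_sumr -big_split /=.
by apply: eq_bigr => i _; rewrite coefD coefZ mulrDl mulrA.
Qed.

HB.instance Definition _ :=
  GRing.isLinear.Build K {poly K} K *%R (@todd K) todd_is_linear.

Lemma todd_Xn n : todd ('X^n : {poly K}) = (-1) ^+ n * bernoulli K n.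
Proof.
rewrite (@todd_widen _ n.+1) ?size_polyXn // big_ord_recr /= coefXn eqxx mul1r.
by rewrite big1 ?add0r // => i _; rewrite coefXn ltn_eqF ?mul0r.
Qed.

Lemma diff_Xn m :
  ('X^m : {poly K}) \Po ('X + 1) - 'X^m = \poly_(k < m) 'C(m, k)%:R.
Proof.
rewrite rmorphXn /= comp_polyX ['X + 1]addrC exprDn poly_def.
rewrite big_ord_recr /= expr1n mul1r binn mulr1n addrK.
by apply: eq_bigr => i _; rewrite expr1n mul1r scaler_nat.
Qed.

(** Under t -> -t the functional becomes D / (e^D - 1) at 0, and e^D - 1 is the forward difference,
    so only D remains. On monomials this is the Bernoulli recurrence. *)
Lemma todd_diff (W : {poly K}) :
  todd ((W \Po ('X + 1) - W) \Po (- 'X)) = W^`().[0].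
Proof.
rewrite -[W]coefK poly_def; move: (size W) => N.
rewrite !linear_sum -big_split /= !linear_sum horner_sum /=.
apply: eq_bigr => -[m _] _ /=.
rewrite comp_polyZ -scalerBr derivZ hornerZ comp_polyZ linearZ; congr (_ * _).
rewrite diff_Xn poly_def !linear_sum /= derivXn hornerMn hornerXn.
transitivity (\sum_(k < m) 'C(m, k)%:R * bernoulli K k).
  apply: eq_bigr => k _; rewrite !linearZ /= rmorphXn /= comp_polyX exprNn -signr_odd.
  rewrite mulr_sign -(@scaler_sign K) linearZ /= todd_Xn signr_odd.
  by rewrite [X in _ * X]mulrA -signr_odd -signr_addb addbb mul1r.
(* Both sides are 1 for m = 1 and 0 for every other m. *)
case: m => [|m]; first by rewrite big_ord0 mulr0n.
rewrite bernoulliE //; case: m => [|m]; first by rewrite expr0.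
by rewrite expr0n mul0rn.
Qed.

Lemma indefinite_sum_exists (q : {poly K}) :
  exists Q, (Q.[0] == 0) && (Q \Po ('X + 1) - Q == q).
Proof.
have [n] := ubnP (size q); elim: n q => // n IH q; rewrite ltnS => le_qn.
have [->|q_neq0] := eqVneq q 0.
  by exists 0; rewrite horner0 comp_poly0 subrr !eqxx.
have [m size_q] : exists m, size q = m.+1.
  by exists (size q).-1; rewrite prednK // size_poly_gt0.
(* The forward difference of t^(m+1) has leading coefficient m + 1, so this multiple cancels the top
   term of [q]. *)
pose c := q`_m / m.+1%:R.
have [|Q /andP[/eqP Q0 /eqP dQ]] := IH (q - c *: \poly_(k < m.+1) 'C(m.+1, k)%:R).
  apply: leq_trans le_qn; rewrite size_q ltnS; apply/leq_sizeP => j.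
  rewrite leq_eqVlt coefB coefZ coef_poly => /predU1P[<-|lt_mj].
    by rewrite ltnS leqnn binSn divfK ?subrr // ((pcharf0P K).1 charK).
  by rewrite ltnNge lt_mj mulr0 subr0 nth_default // size_q.
exists (Q + c *: 'X^(m.+1)).
rewrite hornerD Q0 hornerZ hornerXn expr0n mulr0 addr0 eqxx /=.
rewrite comp_polyD comp_polyZ opprD addrACA dQ -scalerBr diff_Xn.
by rewrite subrK.
Qed.

Definition indefinite_sum (q : {poly K}) : {poly K} :=
  xchoose (indefinite_sum_exists q).

Lemma indefinite_sumP q : is_indefinite_sum q (indefinite_sum q).
Proof. by case/andP: (xchooseP (indefinite_sum_exists q)) => /eqP ? /eqP. Qed.

(** * The family defined by the relations *)

Definition neg_sum (q : {poly K}) := indefinite_sum (q \Po (- 'X)).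

(* The values of the solution at T and at [mirror T], computed together to    *)
(* make the recursion structural.                                             *)
Fixpoint sol_pair (T : pbtree) : {poly K} * {poly K} :=
  if T is Node l r then
    (neg_sum (sol_pair l).2 * (sol_pair r).1,
     neg_sum (sol_pair r).1 * (sol_pair l).2)
  else (1, 1).

Definition sol T := (sol_pair T).1.

Lemma sol_mirror T : sol (mirror T) = (sol_pair T).2.
Proof.
suff eqT : sol_pair (mirror T) = ((sol_pair T).2, (sol_pair T).1).
  by rewrite /sol eqT.
by elim: T => //= l -> r ->.
Qed.

Definition left_sol T := neg_sum (sol (mirror T)).

Lemma sol_Node l r : sol (Node l r) = left_sol l * sol r.
Proof. by rewrite /left_sol sol_mirror. Qed.

Lemma left_sol0 T : (left_sol T).[0] = 0.
Proof. by case: (indefinite_sumP (sol (mirror T) \Po (- 'X))). Qed.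

Lemma left_sol_diff T :
  left_sol T \Po ('X + 1) - left_sol T = sol (mirror T) \Po (- 'X).
Proof. by case: (indefinite_sumP (sol (mirror T) \Po (- 'X))). Qed.

Lemma todd_sol_mirror T : todd (sol (mirror T)) = (left_sol T)^`().[0].
Proof.
rewrite -todd_diff left_sol_diff -comp_polyA rmorphN /= comp_polyX opprK.
by rewrite comp_polyXr.
Qed.

Lemma left_sol_diffN T :
  (left_sol T \Po - 'X) - ((left_sol T \Po - 'X) \Po ('X + 1))
  = sol (mirror T) \Po ('X + 1).
Proof.
have := congr1 (fun p : {poly K} => p \Po (- ('X + 1))) (left_sol_diff T).
rewrite /= comp_polyB -!comp_polyA !comp_polyD !rmorphN /= !comp_polyX.
by rewrite !comp_polyC opprK opprD subrK.
Qed.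

(* Summation by parts.  The product vanishes to order two at 0, so both sides *)
(* of the mirror have the same linear coefficient.                            *)
Lemma left_sol_mirror_Node l r :
  left_sol (mirror (Node l r)) =
  (left_sol l \Po - 'X) * left_sol (mirror r) - (left_sol (Node l r) \Po - 'X).
Proof.
apply: (@is_indefinite_sum_uniq _ charK (sol (Node l r) \Po - 'X)).
  by split; rewrite ?left_sol0 // left_sol_diff mirrorK.
split.
  rewrite hornerD hornerN hornerM !horner_comp hornerN hornerX oppr0.
  by rewrite !left_sol0 mulr0 subrr.
rewrite comp_polyB comp_polyM sol_Node comp_polyM.
have dr := left_sol_diff (mirror r); rewrite mirrorK in dr.
have dT := left_sol_diffN (Node l r); rewrite /= sol_Node comp_polyM in dT.
have dl := left_sol_diffN l.
(* The suffix 1 marks the shift t -> t + 1; what remains is a ring identity in [a], [w], [u] and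
   their shifts. *)
set a := left_sol l \Po - 'X in dl *; set w := left_sol (mirror r) in dr *.
set u := _ \Po - 'X in dT *; set u1 := u \Po _ in dT *.
set a1 := a \Po _ in dl *; set w1 := w \Po _ in dr dT *.
rewrite -dr; move: dT; rewrite -dl => dT.
have -> : u1 = u - w1 * (a - a1) by rewrite -dT opprB addrC subrK.
by ring.
Qed.

Lemma todd_mirror T : todd (sol (mirror T)) = todd (sol T).
Proof.
case: T => // l r; rewrite todd_sol_mirror -[in RHS](mirrorK (Node l r)).
rewrite todd_sol_mirror left_sol_mirror_Node derivB derivM !deriv_comp.
rewrite derivN derivX !(hornerD, hornerN, hornerM, horner_comp, hornerX, hornerC).
by rewrite oppr0 !left_sol0 mulr0 mul0r !add0r mulrN1 opprK.
Qed.

(** * The flow equation for the family *)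

Local Notation flow := (cut_sum (fun T => todd (sol T))).

(** Both sides have the same forward difference: the sign from differentiating at -t is the sign in
    [cut_sum_mirror]. They agree at 0, where the cut sum vanishes and [todd_mirror] identifies the
    constant. *)
Lemma deriv_left_sol T :
    (sol (mirror T))^`() = flow true (mirror T) sol ->
  (left_sol T)^`() = (todd (sol T))%:P + flow false T left_sol.
Proof.
move=> dT; apply/eqP; rewrite addrC -subr_eq -subr_eq0; apply/eqP.
have cut0 : (flow false T left_sol).[0] = 0.
  by rewrite horner_sum big1 // => c _; rewrite hornerZ left_sol0 mulr0.
apply: (@is_indefinite_sum_uniq _ charK 0).
  split.
    rewrite !hornerD !hornerN cut0 subr0 hornerC -todd_sol_mirror todd_mirror.
    exact: subrr.
  transitivity ((left_sol T)^`() \Po ('X + 1) - (left_sol T)^`()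
      - flow false T (fun x => left_sol x \Po ('X + 1) - left_sol x)).
    by rewrite !comp_polyB comp_polyC cut_sum_comp cut_sumB; ring.
  have -> : (left_sol T)^`() \Po ('X + 1) - (left_sol T)^`()
    = ((left_sol T \Po ('X + 1)) - left_sol T)^`().
    by rewrite derivB deriv_comp derivD derivX derivC addr0 mulr1.
  rewrite (eq_cut_sum _ _ _ left_sol_diff) left_sol_diff deriv_comp dT.
  rewrite derivN derivX mulrN1 cut_sum_comp (cut_sum_mirror todd_mirror false).
  by rewrite opprK subrr.
by split; rewrite ?horner0 // comp_poly0 subrr.
Qed.

(** The Leibniz rule for [left_sol l * sol r] yields the root cut (the Todd constant), the cuts in
    [l] and those in [r]. As [left_sol l] involves [mirror l], a tree and its mirror are treated
    together. *)
Lemma deriv_sol T : (sol T)^`() = flow true T sol.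
Proof.
suff [] : (sol T)^`() = flow true T sol
  /\ (sol (mirror T))^`() = flow true (mirror T) sol by [].
have step l r : (sol (mirror l))^`() = flow true (mirror l) sol ->
    (sol r)^`() = flow true r sol ->
    (sol (Node l r))^`() = flow true (Node l r) sol.
  move=> /deriv_left_sol dl dr.
  rewrite sol_Node derivM dl dr cut_sum_Node mulrDl mul_polyC.
  rewrite -cut_sumMl mulrC -cut_sumMl; congr (_ + _ + _); apply: eq_cut_sum => x.
    by rewrite sol_Node mulrC.
  by rewrite sol_Node.
elim: T => [|l [dl dml] r [dr dmr]] /=.
  by rewrite /sol /= derivC /cut_sum big_nil.
by split; apply: step; rewrite ?mirrorK.
Qed.

Lemma sol_solves_flow : solves_flow sol.
Proof.
split=> S; first by rewrite deriv_sol prelie_cut_sum.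
case: S => [|l r]; first by rewrite hornerC eqxx.
by rewrite sol_Node hornerM left_sol0 mul0r.
Qed.

(** * The relations and their uniqueness *)

Lemma sol_tree_relations : tree_relations (fun T => sol (Phi_inv T)).
Proof.
have left_solE T : sol (Phi_inv (PRoot [:: T])) = left_sol (mirror (Phi_inv T)).
  by rewrite /= sol_Node mulr1.
split=> // [s _ | T].
  under eq_bigr do rewrite left_solE.
  elim: s => [|T s IHs]; first by rewrite big_nil.
  by rewrite big_cons -IHs /= sol_Node.
(* The mirror in [Phi_inv] cancels the one in [left_sol]. *)
by rewrite left_solE /left_sol mirrorK; apply: indefinite_sumP.
Qed.

Lemma tree_relations_uniq (Q Q' : prtree -> {poly K}) :
  tree_relations Q -> tree_relations Q' -> Q =1 Q'.
Proof.
move=> [Q1 QM QS] [Q1' QM' QS']; elim/prtree_ind_seq => -[|T s] IH.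
  by rewrite -/bullet Q1 Q1'.
rewrite QM // QM' //; elim: (T :: s) IH => [|U u IHu] /=; first by rewrite !big_nil.
case=> QU /IHu eq_u; rewrite !big_cons eq_u; congr (_ * _).
by apply: (is_indefinite_sum_uniq charK (QS U)); rewrite QU; apply: QS'.
Qed.

End Polynomials.

Theorem theorem3p43 (K : fieldType) (charK : [pchar K] =i pred0)
    (P : series {poly K}) (solvesP : solves_flow P) :
  tree_relations (fun T : prtree => P (Phi_inv T))
  /\ (forall Q : prtree -> {poly K}, tree_relations Q ->
        forall T : prtree, Q T = P (Phi_inv T)).
Proof.
have Psol T : sol charK T = P T.
  exact: (solves_flow_uniq charK (sol_solves_flow charK) solvesP).
have [sol1 solM solS] := sol_tree_relations charK.
suff relP : tree_relations (fun T => P (Phi_inv T)).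
  by split=> // Q relQ; apply: (tree_relations_uniq charK relQ relP).
split=> [|s s_gt0|T]; rewrite -?Psol //.
  by rewrite (solM s s_gt0); apply: eq_bigr => T _; rewrite Psol.
Qed.
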